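(* The following spaces are isometrically isomorphic for $1\leq p <\infty$: $G^{p}\cong \ell^{p}(\mathfrak c, L^{p}[0,1])$.
   Context: Let $\mathcal{B}$ be the Borel $\sigma$-algebra of $\mathbb{R}$, $\lambda$ the Lebesgue measure, and $\mathcal{B}_{\infty}$ the $\sigma$-algebra on $\mathbb{R}^{\mathbb{N}}$ generated by the cylinder sets $\prod_{i=1}^{m}C_{i}\times\prod_{i=m+1}^{\infty}\mathbb{R}$ with $C_i\in\mathcal{B}$, $m\in\mathbb{N}$. Let $\mathcal{F}(\mathcal{B},\lambda)$ be the set of finite rectangles $\prod_{i\in\mathbb{N}}C_{i}$ with $C_i\in\mathcal{B}$ and $\prod_{i}\lambda(C_i)\in[0,\infty)$, with $\mathrm{vol}(\prod_{i}C_i):=\prod_i\lambda(C_i)$. The measure $\mu$ is the restriction to $\mathcal{B}_{\infty}$ of the outer measure $\mu^{\ast}(A):=\inf\{\sum_{n}\mathrm{vol}(\mathscr{C}_{n}) : \mathscr{C}_{n}\in\mathcal{F}(\mathcal{B},\lambda),\ A\subset\bigcup_{n}\mathscr{C}_{n}\}$ ($\inf\varnothing=\infty$). Let $I:=\mathbb{Z}^{\mathbb{N}}$ and, for $\mathfrak{a}=(a_n)\in I$, $\mathcal{C}_{\mathfrak{a}}:=\prod_{n\in\mathbb{N}}[a_{n},a_{n}+1)$. For $f\in L^p(\mu)$ let $\mathcal{O}_{f}:=\{\mathfrak{a}\in I : \int_{\mathcal{C}_{\mathfrak{a}}}|f|^{p}\,d\mu\neq 0\}$ and $\mathcal{F}_{f}:=\bigsqcup_{\mathfrak{a}\in\mathcal{O}_{f}}\mathcal{C}_{\mathfrak{a}}$.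 Define $G^{p}:=\{f\in L^{p}(\mu) : \int_{\mathbb{R}^{\mathbb{N}}}|f|^{p}\,d\mu=\sum_{\mathfrak{a}\in\mathcal{O}_{f}}\int_{\mathcal{C}_{\mathfrak{a}}}|f|^{p}\,d\mu=\int_{\mathcal{F}_{f}}|f|^{p}\,d\mu\}$ (a linear subspace of $L^p(\mu)$ with the $L^p$ norm). $\ell^{p}(\kappa,X)$ denotes the $\ell^p$-sum of $\kappa$ copies of the Banach space $X$, and $\mathfrak{c}$ is the cardinality of the continuum. *)

(* Defs.v *)
From HB Require Import structures.
From mathcomp Require Import all_boot all_order all_algebra.
From mathcomp Require Import all_classical all_reals all_analysis.
Set Implicit Arguments. Unset Strict Implicit. Unset Printing Implicit Defensive.
Import Order.TTheory GRing.Theory Num.Theory.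
Import numFieldNormedType.Exports.
Local Open Scope classical_set_scope.
Local Open Scope ring_scope.

Section Defs.
Variable R : realType.

(** Cylinder sets  C_0 x ... x C_(m-1) x R x R x ...  with Borel C_i
    (indices of R^N start at 0 here instead of 1). *)
Definition cylinders : set (set (nat -> R)) :=
  [set A | exists (m : nat) (C : nat -> set R),
      (forall i, measurable (C i)) /\
      A = [set x | forall i, (i < m)%N -> C i (x i)]].

Definition RN := g_sigma_algebraType cylinders.

Definition leb : set R -> \bar R := @lebesgue_measure R.

Definition rect (C : nat -> set R) : set (nat -> R) :=
  [set x | forall i, C i (x i)].

(** [C] defines a finite rectangle (element of F(B,lambda)) of volume [v]:
    all C_i are Borel and the infinite product prod_i lambda(C_i), i.e. the
    limit of the partial products in [0,+oo], exists and equals the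
    finite number v. *)
Definition finite_rect (C : nat -> set R) (v : R) : Prop :=
  (forall i, measurable (C i)) /\
  ((fun n : nat => (\prod_(i < n) leb (C i))%E) @ \oo --> v%:E).

Definition mustar (A : set (nat -> R)) : \bar R :=
  ereal_inf [set s | exists (C : nat -> nat -> set R) (v : nat -> R),
     (forall n, finite_rect (C n) (v n)) /\
     A `<=` \bigcup_n rect (C n) /\
     s = (\sum_(0 <= n <oo) (v n)%:E)%E].

Definition cube (a : nat -> int) : set RN :=
  [set x | forall n, (a n)%:~R <= x n < (a n)%:~R + 1].

Section Lp.
Variables (mu : {measure set RN -> \bar R}) (p : R).

Definition pint (D : set RN) (f : RN -> R) : \bar R :=
  (\int[mu]_(x in D) ((`|f x| `^ p)%:E))%E.

(** f is in L^p(mu) (as a representative). *)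
Definition inLp (f : RN -> R) : Prop :=
  measurable_fun setT f /\ (pint setT f < +oo)%E.

Definition Ocal (f : RN -> R) : set (nat -> int) :=
  [set a | pint (cube a) f != 0%E].

Definition Fcal (f : RN -> R) : set RN := \bigcup_(a in Ocal f) cube a.

Definition inGp (f : RN -> R) : Prop :=
  inLp f /\
  pint setT f = (\esum_(a in Ocal f) pint (cube a) f)%E /\
  (\esum_(a in Ocal f) pint (cube a) f)%E = pint (Fcal f) f.

Definition Gp_norm (f : RN -> R) : \bar R := (pint setT f `^ p^-1)%E.
End Lp.

Section lp.
Variable p : R.
Definition pint01 (g : R -> R) : \bar R :=
  (\int[@lebesgue_measure R]_(x in `[0%R, 1%R]%classic) ((`|g x| `^ p)%:E))%E.

(** Elements of l^p(c, L^p[0,1]): families indexed by R (|R| = c) of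
    representatives of L^p[0,1]-functions with sum_k ||u_k||^p < oo. *)
Definition inlp (u : R -> R -> R) : Prop :=
  (forall k : R, measurable_fun (`[0%R, 1%R]%classic : set (measurableTypeR R)) (u k)) /\
  (\esum_(k in [set: R]) pint01 (u k) < +oo)%E.

Definition lp_norm (u : R -> R -> R) : \bar R :=
  ((\esum_(k in [set: R]) pint01 (u k)) `^ p^-1)%E.
End lp.

End Defs.

(* Main.v *)
Require Import Defs.
From HB Require Import structures.
From mathcomp Require Import all_boot all_order all_algebra finmap.
From mathcomp Require Import all_classical all_reals all_analysis.
From mathcomp Require Import measurable_realfun.
From mathcomp Require Import ring lra zify.
Import Order.TTheory GRing.Theory Num.Theory.
Import numFieldNormedType.Exports.
Local Open Scope classical_set_scope.
Local Open Scope ring_scope.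

(** Each cube [C_a], with the restriction of [mu], is isomorphic modulo null sets
    to [[0, 1[] with the Lebesgue measure [lambda]. Interleaving binary digits
    gives a measurable map from the unit square to [[0, 1[] that sends dyadic
    squares onto dyadic intervals, hence transports [lambda x lambda] to [lambda];
    its left inverse splits a number into the number formed by its even digits and
    the number formed by its odd ones. Splitting off the even digits repeatedly
    turns one uniform number into a sequence of independent uniform numbers,
    from which it can be recovered almost surely. Call [P_a] the law of this
    sequence translated by [a]. A finite rectangle has [P_a]-measure at most its
    volume, so [P_a A <= mu (A `&` C_a)] for all measurable [A]; as
    [mu C_a <= 1 = P_a C_a], applying this to the complement of [A] gives equality.
    The isometry composes [f] with these parametrizations of the cubes, which are
    indexed by the reals through a bijection between the reals and the sequences
    of integers. A family in [l^p] has countable support, so it can be glued back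
    into a function that is measurable on countably many cubes and vanishes
    elsewhere. *)

(** * Binary expansions *)

Fixpoint bprefix (b : nat -> bool) (n : nat) : nat :=
  if n is m.+1 then ((bprefix b m).*2 + b m)%N else 0%N.

(** Rules out the second expansion, ending in ones, of a dyadic rational; on the remaining sequences
    [digit] inverts [bval]. *)
Definition not_eventually1 (b : nat -> bool) :=
  forall n : nat, exists2 m : nat, (n <= m)%N & ~~ b m.

Section binary_expansion.
Context {R : realType}.
Implicit Types (x : R) (b : nat -> bool).

Definition bapprox b (n : nat) : R := (bprefix b n)%:R / 2 ^+ n.

Definition bval b : R := limn (bapprox b).

Definition digit (k : nat) x : bool := odd (Num.truncn (2 ^+ k.+1 * x)).

Let pow2_gt0 n : 0 < 2 ^+ n :> R. Proof. exact: exprn_gt0. Qed.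

Lemma bapproxS b n : bapprox b n.+1 = bapprox b n + (b n)%:R / 2 ^+ n.+1.
Proof.
rewrite /bapprox /= natrD -mul2n natrM exprS.
by field; rewrite gt_eqF.
Qed.

Lemma half_pow2 n : (2 ^+ n)^-1 = 2 * (2 ^+ n.+1)^-1 :> R.
Proof. by rewrite exprS; field; rewrite gt_eqF. Qed.

Lemma near_pow2V_lt {e : R} : 0 < e -> \forall n \near \oo, (2 ^+ n)^-1 < e.
Proof.
move=> e0; have := @cvg_expr R 2^-1.
rewrite gtr0_norm ?invr_gt0// invf_lt1// ltr1n => /(_ isT)/cvgrPdist_lt/(_ _ e0).
apply: filterS => n.
by rewrite sub0r normrN exprVn ger0_norm// invr_ge0 ltW.
Qed.

Lemma nondecreasing_bapprox b : nondecreasing_seq (bapprox b).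
Proof.
apply/nondecreasing_seqP => n; rewrite bapproxS lerDl.
by rewrite divr_ge0// exprn_ge0.
Qed.

(** Together with the monotonicity of [bapprox], this encloses [bval b] in nested intervals of
    length [2^-n]. *)
Lemma nonincreasing_bapproxV b :
  nonincreasing_seq (fun n => bapprox b n + (2 ^+ n)^-1).
Proof.
apply/nonincreasing_seqP => n; rewrite bapproxS (half_pow2 n).
have : 0 < (2 ^+ n.+1)^-1 :> R by rewrite invr_gt0.
by case: (b n) => /=; rewrite ?mul0r ?mul1r ?addr0; lra.
Qed.

Lemma bapprox_le b n m : bapprox b n <= bapprox b m + (2 ^+ m)^-1.
Proof.
have [nm|/ltnW mn] := leqP n m.
  by apply: (le_trans (nondecreasing_bapprox b _ _ nm)); rewrite lerDl invr_ge0 ltW.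
apply: le_trans (nonincreasing_bapproxV b _ _ mn).
by rewrite lerDl invr_ge0 ltW.
Qed.

Lemma cvg_bapprox b : bapprox b @ \oo --> bval b.
Proof.
apply: nondecreasing_is_cvgn; first exact: nondecreasing_bapprox.
by exists (bapprox b 0 + (2 ^+ 0)^-1) => _ [n _ <-]; exact: bapprox_le.
Qed.

Lemma bval_ge b n : bapprox b n <= bval b.
Proof.
apply: nondecreasing_cvgn_le; first exact: nondecreasing_bapprox.
by apply/cvg_ex; exists (bval b); exact: cvg_bapprox.
Qed.

Lemma bval_le b n : bval b <= bapprox b n + (2 ^+ n)^-1.
Proof.
apply: limr_le; first by apply/cvg_ex; exists (bval b); exact: cvg_bapprox.
by near=> m; exact: bapprox_le.
Unshelve. all: end_near. Qed.

(** A zero digit at some [m >= n] leaves the approximation unchanged while the error term halves, so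
    the upper bound drops strictly there. *)
Lemma bval_lt b n : not_eventually1 b -> bval b < bapprox b n + (2 ^+ n)^-1.
Proof.
move=> /(_ n)[m nm bm]; apply: le_lt_trans (bval_le b m.+1) _.
apply: lt_le_trans (nonincreasing_bapproxV b _ _ nm).
rewrite bapproxS (negbTE bm) mul0r addr0 ltrD2l.
by rewrite ltf_pV2 ?posrE// ltr_eXn2l// ltr1n.
Qed.

Lemma bval_ge0 b : 0 <= bval b.
Proof. by have := bval_ge b 0; rewrite /bapprox mul0r. Qed.

Lemma bval_le1 b : bval b <= 1.
Proof. by have := bval_le b 0; rewrite /bapprox mul0r add0r invr1. Qed.

Lemma bval_lt1 b : not_eventually1 b -> bval b < 1.
Proof. by move=> /(bval_lt b 0); rewrite /bapprox mul0r add0r invr1. Qed.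

Lemma truncn_bval b n : not_eventually1 b ->
  Num.truncn (2 ^+ n * bval b) = bprefix b n.
Proof.
move=> b1; apply: truncn_def; apply/andP; split.
  by rewrite mulrC -ler_pdivrMr//; exact: bval_ge.
rewrite mulrC -ltr_pdivlMr// -natr1 mulrDl mul1r; exact: bval_lt.
Qed.

Lemma digit_bval b k : not_eventually1 b -> digit k (bval b) = b k.
Proof.
move=> b1; rewrite /digit truncn_bval//= oddD odd_double.
by case: (b k).
Qed.

(** Doubling a number of integer part [t] gives integer part [2t] or [2t + 1], and [digit] is the
    parity telling which. *)
Lemma truncnS_digit x n : 0 <= x ->
  Num.truncn (2 ^+ n.+1 * x) = ((Num.truncn (2 ^+ n * x)).*2 + digit n x)%N.
Proof.
move=> x0; rewrite /digit.
have y0 : 0 <= 2 ^+ n * x by rewrite mulr_ge0// ltW.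
have -> : 2 ^+ n.+1 * x = 2 * (2 ^+ n * x) by rewrite exprS mulrA.
move: (2 ^+ n * x) y0 => y y0.
have /andP[hl hu] := truncn_itv y0.
set t := Num.truncn y in hl hu *.
have y20 : 0 <= 2 * y by rewrite mulr_ge0.
rewrite -{1}(odd_double_half (Num.truncn (2 * y))) addnC; congr (_.*2 + _)%N.
have : (t.*2 <= Num.truncn (2 * y))%N.
  by rewrite truncn_ge_nat// -mul2n natrM; lra.
have : (Num.truncn (2 * y) < t.*2.+2)%N.
  rewrite truncn_lt_nat// (_ : t.*2.+2 = 2 * t.+1)%N; last lia.
  by rewrite natrM; lra.
lia.
Qed.

Lemma bprefix_digit x n : 0 <= x < 1 ->
  bprefix (digit^~ x) n = Num.truncn (2 ^+ n * x).
Proof.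
move=> /andP[x0 x1]; elim: n => [|n IH]; last by rewrite truncnS_digit//= IH.
by rewrite expr0 mul1r; apply/esym/truncn_def; rewrite x0 x1.
Qed.

Lemma bapprox_digit_le x n : 0 <= x < 1 -> bapprox (digit^~ x) n <= x.
Proof.
move=> x01; rewrite /bapprox bprefix_digit// ler_pdivrMr// mulrC truncn_le.
by case/andP: x01 => x0 _; rewrite mulr_ge0// ltW.
Qed.

Lemma bapprox_digit_gt x n : 0 <= x < 1 ->
  x < bapprox (digit^~ x) n + (2 ^+ n)^-1.
Proof.
move=> x01; rewrite /bapprox bprefix_digit//.
by rewrite -[X in _ + X]mul1r -mulrDl natr1 ltr_pdivlMr// mulrC truncnS_gt.
Qed.

Lemma bval_digit x : 0 <= x < 1 -> bval (digit^~ x) = x.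
Proof.
move=> x01; apply/eqP; rewrite eq_le; apply/andP; split.
  apply: limr_le; first by apply/cvg_ex; eexists; exact: cvg_bapprox.
  by near=> m; exact: bapprox_digit_le.
apply/ler_addgt0Pr => e e0.
have [n _ /(_ n (leqnn n)) /ltW ne] := near_pow2V_lt e0.
apply: le_trans (ltW (bapprox_digit_gt x n x01)) _.
by rewrite lerD//; exact: bval_ge.
Unshelve. all: end_near. Qed.

(** If all digits from [n] on were ones, the upper bounds would be constant from there on; as the
    error tends to zero, [x] would reach that constant, against [bapprox_digit_gt]. *)
Lemma not_eventually1_digit x : 0 <= x < 1 -> not_eventually1 (digit^~ x).
Proof.
move=> x01 n; apply: contrapT => H.
have d1 m : (n <= m)%N -> digit m x.
  by move=> nm; apply/negPn/negP => dm; apply: H; exists m.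
have E m : (n <= m)%N -> bapprox (digit^~ x) m + (2 ^+ m)^-1 =
    bapprox (digit^~ x) n + (2 ^+ n)^-1.
  elim: m => [|m IH]; first by rewrite leqn0 => /eqP ->.
  rewrite leq_eqVlt ltnS => /orP[/eqP ->//|nm].
  by rewrite -IH// bapproxS d1// mul1r -addrA; congr (_ + _); rewrite (half_pow2 m); ring.
suff : bapprox (digit^~ x) n + (2 ^+ n)^-1 <= x by rewrite leNgt bapprox_digit_gt.
apply/ler_addgt0Pr => e e0.
have [N _ HN] := near_pow2V_lt e0.
rewrite -(E (maxn n N)) ?leq_maxl// lerD//; last by apply/ltW/HN; exact: leq_maxr.
exact: bapprox_digit_le.
Qed.

End binary_expansion.

(** * Interleaving of digits *)

Definition interleave (b c : nat -> bool) (k : nat) : bool :=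
  if odd k then c k./2 else b k./2.

Lemma interleave_even b c k : interleave b c k.*2 = b k.
Proof. by rewrite /interleave odd_double doubleK. Qed.

Lemma interleave_odd b c k : interleave b c k.*2.+1 = c k.
Proof. by rewrite /interleave /= odd_double uphalf_double. Qed.

Lemma not_eventually1_interleave b c :
  not_eventually1 b -> not_eventually1 (interleave b c).
Proof.
move=> b1 n; have [m nm bm] := b1 n; exists m.*2; last by rewrite interleave_even.
by rewrite -addnn (leq_trans nm)// leq_addr.
Qed.

Section unit_square.
Context {R : realType}.
Implicit Types (x y : R).

Definition merge01 (xy : R * R) : R :=
  bval (interleave (digit^~ xy.1) (digit^~ xy.2)).

Definition evens (x : R) : R := bval (fun k => digit k.*2 x).

Definition odds (x : R) : R := bval (fun k => digit k.*2.+1 x).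

Lemma merge01_itv x y : 0 <= x < 1 -> 0 <= merge01 (x, y) < 1.
Proof.
move=> x01; rewrite bval_ge0 bval_lt1//.
exact/not_eventually1_interleave/not_eventually1_digit.
Qed.

Lemma digit_merge01_even x y k : 0 <= x < 1 ->
  digit k.*2 (merge01 (x, y)) = digit k x.
Proof.
move=> x01; rewrite digit_bval ?interleave_even//.
exact/not_eventually1_interleave/not_eventually1_digit.
Qed.

Lemma digit_merge01_odd x y k : 0 <= x < 1 ->
  digit k.*2.+1 (merge01 (x, y)) = digit k y.
Proof.
move=> x01; rewrite digit_bval ?interleave_odd//.
exact/not_eventually1_interleave/not_eventually1_digit.
Qed.

Lemma evens_merge01 x y : 0 <= x < 1 -> evens (merge01 (x, y)) = x.
Proof.
move=> x01; rewrite -[RHS]bval_digit//; congr bval.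
by apply/funext => k; exact: digit_merge01_even.
Qed.

Lemma odds_merge01 x y : 0 <= x < 1 -> 0 <= y < 1 -> odds (merge01 (x, y)) = y.
Proof.
move=> x01 y01; rewrite -[RHS]bval_digit//; congr bval.
by apply/funext => k; exact: digit_merge01_odd.
Qed.

(* [merge01] maps dyadic squares of side [2^-n] onto dyadic intervals of length
   [4^-n]. *)
Lemma truncn_merge01 (n j : nat) : (j < 2 ^ n.*2)%N ->
  exists a b : nat, [/\ (a < 2 ^ n)%N, (b < 2 ^ n)%N &
    forall x y, 0 <= x < 1 -> 0 <= y < 1 ->
      Num.truncn (2 ^+ n.*2 * merge01 (x, y)) = j <->
      Num.truncn (2 ^+ n * x) = a /\ Num.truncn (2 ^+ n * y) = b].
Proof.
elim: n j => [|n IH] j.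
  rewrite double0 expn0 ltnS leqn0 => /eqP ->; exists 0%N, 0%N; split => // x y x01 y01.
  have T0 z : 0 <= z < 1 -> Num.truncn (2 ^+ 0 * z : R) = 0%N.
    by move=> z01; apply: truncn_def; rewrite mul1r.
  by rewrite !T0//; exact: merge01_itv.
rewrite doubleS => jlt.
(* Two digits are appended to the prefix [j./2./2]: [odd j./2] comes from [x] and [odd j] from
   [y]. *)
have /IH[a [b [alt blt H]]] : (j./2./2 < 2 ^ n.*2)%N.
  by move: jlt; rewrite !expnS; lia.
exists (a.*2 + odd j./2)%N, (b.*2 + odd j)%N; split.
- by rewrite expnS; case: (odd _); lia.
- by rewrite expnS; case: (odd _); lia.
move=> x y x01 y01; have [/andP[x0 _] /andP[y0 _]] := (x01, y01).
have /andP[m0 _] := merge01_itv x y x01.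
rewrite !truncnS_digit// digit_merge01_even// digit_merge01_odd//.
have {}H := H x y x01 y01.
have jE : j = ((j./2./2).*2 + odd j./2).*2 + odd j :> nat by lia.
move: jE H; move: (odd j./2) (odd j) j./2./2 => o1 o2 j4 ->.
move: (Num.truncn (2 ^+ n.*2 * _)) (Num.truncn (_ * x)) (Num.truncn (_ * y)).
move: (digit n x) (digit n y) => d1 d2 t t1 t2 H; split.
  move=> E; have [//|E1 E2] := (proj1 H); first by move: E; lia.
  by move: E E1 E2; lia.
move=> [E1 E2]; have E := proj2 H; have : t = j4 by apply: E; lia.
by move: E1 E2 {E H}; lia.
Qed.

Lemma measurable_digit k : measurable_fun setT (@digit R k).
Proof.
apply: (measurable_fun_bool true); rewrite setTI.
rewrite (_ : _ @^-1` _ = \bigcup_n [set x : R |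
    n.*2.+1%:R <= 2 ^+ k.+1 * x < n.*2.+2%:R]).
  apply: bigcupT_measurable => n.
  have -> : [set x : R | n.*2.+1%:R <= 2 ^+ k.+1 * x < n.*2.+2%:R] =
     `[n.*2.+1%:R / 2 ^+ k.+1, n.*2.+2%:R / 2 ^+ k.+1[%classic.
    apply/seteqP; split => x /=; rewrite in_itv/=.
      by rewrite ler_pdivrMr ?exprn_gt0// ltr_pdivlMr ?exprn_gt0// mulrC.
    by rewrite ler_pdivrMr ?exprn_gt0// ltr_pdivlMr ?exprn_gt0// mulrC.
  exact: measurable_itv.
apply/seteqP; split => x /=; rewrite /digit.
  move=> ox; exists (Num.truncn (2 ^+ k.+1 * x))./2 => //=.
  rewrite -truncn_gt_nat -truncn_le_nat.
  by move: (Num.truncn _) ox => t ot; have := odd_double_half t; rewrite ot; lia.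
move=> [n _ /=]; rewrite -truncn_gt_nat -truncn_le_nat => h.
have -> : Num.truncn (2 ^+ k.+1 * x) = n.*2.+1.
  by move: (Num.truncn _) h => t h; apply/eqP; rewrite eqn_leq andbC.
by rewrite /= odd_double.
Qed.

Lemma measurable_bval d (T : measurableType d) (B : nat -> T -> bool) :
  (forall k, measurable_fun setT (B k)) ->
  measurable_fun setT (fun t => bval (B^~ t) : R).
Proof.
move=> mB; apply: (@measurable_fun_cvg _ _ _ setT (fun n t => bapprox (B^~ t) n)).
  elim=> [|n IH].
    rewrite (_ : (fun _ => _) = cst 0); first exact: measurable_cst.
    by apply/funext => t; rewrite /bapprox /= mul0r.
  rewrite (_ : (fun _ => _) = (fun t =>
    bapprox (B^~ t) n + ((B n t)%:R / 2 ^+ n.+1 : R))); last first.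
    by apply/funext => t; rewrite bapproxS.
  apply: measurable_funD => //.
  by apply: (@measurableT_comp _ _ _ _ _ _ (fun b : bool => b%:R / 2 ^+ n.+1 : R)).
by move=> t _; exact: cvg_bapprox.
Qed.

Lemma measurable_evens : measurable_fun setT evens.
Proof. by apply: measurable_bval => k; exact: measurable_digit. Qed.

Lemma measurable_odds : measurable_fun setT odds.
Proof. by apply: measurable_bval => k; exact: measurable_digit. Qed.

Lemma measurable_merge01 : measurable_fun setT merge01.
Proof.
apply: measurable_bval => k; rewrite /interleave; case: (odd k).
  by apply: measurableT_comp => //; exact: measurable_digit.
by apply: measurableT_comp => //; exact: measurable_digit.
Qed.

(** A measure on the whole line carried by [[0, 1[], so that the digit maps, defined on all of [R],
    act on it without a subtype. *)
Definition unif : set (measurableTypeR R) -> \bar R :=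
  mrestr (@lebesgue_measure R) (measurable_itv `[0, 1[).

HB.instance Definition _ := Measure.on unif.

Let unif_setT : unif setT = 1%E.
Proof.
rewrite /unif /mrestr setTI lebesgue_measure_itv /= lte_fin ltr01.
by rewrite -EFinB subr0.
Qed.

HB.instance Definition _ := Measure_isProbability.Build _ _ _ unif unif_setT.

Lemma unif_itv01 : unif `[0, 1[ = 1%E.
Proof. by rewrite /unif /mrestr setIid -[RHS]unif_setT /unif /mrestr setTI. Qed.

Lemma dyadicE (n a : nat) : (a < 2 ^ n)%N ->
  [set x : R | 0 <= x < 1 /\ Num.truncn (2 ^+ n * x) = a] =
  `[a%:R / 2 ^+ n, a.+1%:R / 2 ^+ n[%classic.
Proof.
move=> alt; have p0 : 0 < 2 ^+ n :> R by rewrite exprn_gt0.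
apply/seteqP; split => x /=; rewrite in_itv/=.
  move=> [/andP[x0 x1] <-].
  rewrite ler_pdivrMr// ltr_pdivlMr// mulrC truncnS_gt andbT truncn_le.
  by rewrite mulr_ge0// ltW.
rewrite ler_pdivrMr// ltr_pdivlMr// => /andP[ax xa]; split.
  have x0 : 0 <= x by rewrite -(pmulr_lge0 _ p0) (le_trans _ ax).
  rewrite x0 /= -(ltr_pM2r p0) mul1r (lt_le_trans xa)//.
  by rewrite -natrX ler_nat.
by apply: truncn_def; rewrite mulrC ax xa.
Qed.

Lemma unif_dyadic (n a : nat) : (a < 2 ^ n)%N ->
  unif `[a%:R / 2 ^+ n, a.+1%:R / 2 ^+ n[ = ((2 ^+ n)^-1)%:E.
Proof.
move=> alt; have p0 : 0 < 2 ^+ n :> R by rewrite exprn_gt0.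
rewrite /unif /mrestr setIidl; last first.
  by rewrite -dyadicE// => x [x01 _]; rewrite /= in_itv.
rewrite lebesgue_measure_itv /= lte_fin ltr_pM2r ?invr_gt0// ltr_nat leqnn.
by rewrite -EFinB -mulrBl -natrB// subSnn mul1r.
Qed.

End unit_square.

(** * Events of full probability *)

Lemma probability_setC1 d (T : measurableType d) (R : realType)
    (P : probability T R) (A : set T) :
  measurable A -> P A = 1%E -> P (~` A) = 0%E.
Proof. by move=> mA A1; rewrite probability_setC// A1 subee. Qed.

(** Allows an event to be cut down to a set of full measure, such as the unit square, where the
    digit identities hold. *)
Lemma probability_setI1 d (T : measurableType d) (R : realType)
    (P : probability T R) (D A : set T) :
  measurable D -> measurable A -> P D = 1%E -> P A = P (A `&` D).
Proof.
move=> mD mA D1.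
rewrite (@measureDI _ _ _ P A D)//.
rewrite [X in (X + _)%E](_ : _ = 0%E) ?add0e//.
apply: (@subset_measure0 _ _ _ P _ (~` D)).
- exact: measurableD.
- exact: measurableC.
- by move=> x [].
- exact: probability_setC1.
Qed.

Lemma ae_probability1 d (T : measurableType d) (R : realType)
    (P : probability T R) (A : set T) :
  measurable A -> P A = 1%E -> \forall x \ae P, A x.
Proof.
move=> mA A1; exists (~` A); split; first exact: measurableC.
- exact: probability_setC1.
- exact: subset_refl.
Qed.

(** * The uniform law as the image of the unit square *)

Section uniform_law.
Context {R : realType}.
Local Notation unif := (@unif R).

Section dyadic.
Variable m : probability (measurableTypeR R) R.
Hypothesis m_dyadic : forall n j : nat, (j < 2 ^ n.*2)%N ->
  m `[j%:R / 2 ^+ n.*2, j.+1%:R / 2 ^+ n.*2[%classic = ((2 ^+ n.*2)^-1)%:E.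

Let m_itv_dyadic n J : (J <= 2 ^ n.*2)%N ->
  m `[0, J%:R / 2 ^+ n.*2[%classic = (J%:R / 2 ^+ n.*2)%:E.
Proof.
have p0 : 0 < 2 ^+ n.*2 :> R by rewrite exprn_gt0.
elim: J => [_|J IH Jlt]; first by rewrite mul0r set_itvco0 measure0.
rewrite (@itv_bndbnd_setU _ _ _ (BLeft (J%:R / 2 ^+ n.*2))); last 2 first.
- by rewrite bnd_simp divr_ge0// ltW.
- by rewrite bnd_simp ler_pM2r ?invr_gt0// ler_nat.
have mU (A B : set (measurableTypeR R)) : measurable A -> measurable B ->
    A `&` B = set0 -> m (A `|` B) = (m A + m B)%E by exact: measureU.
rewrite mU//; last first.
  apply/seteqP; split => x //= []; rewrite !in_itv/= => /andP[_ xJ] /andP[Jx _].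
  by move: (lt_le_trans xJ Jx); rewrite ltxx.
rewrite IH ?(ltnW Jlt)// m_dyadic// -EFinD -[in RHS]natr1; congr (_%:E); lra.
Qed.

Let m_itv (t : R) : 0 <= t < 1 -> m `[0, t[%classic = t%:E.
Proof.
move=> /andP[t0 t1].
have mfin : m `[0, t[%classic \is a fin_num by exact: fin_num_measure.
rewrite -(fineK mfin); congr (_%:E); move: (fineK mfin); set r := fine _ => rE.
(* Both [r] and [t] lie between the consecutive dyadic points [J / 4^n] and [(J + 1) / 4^n]. *)
have B n : `|r - t| <= (2 ^+ n)^-1.
  apply: (@le_trans _ _ (2 ^+ n.*2)^-1); last first.
    rewrite lef_pV2 ?posrE ?exprn_gt0// ler_eXn2l ?ltr1n//.
    by rewrite -addnn leq_addr.
  have p0 : 0 < 2 ^+ n.*2 :> R by rewrite exprn_gt0.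
  have ct0 : 0 <= 2 ^+ n.*2 * t by rewrite mulr_ge0// ltW.
  set J := Num.truncn (2 ^+ n.*2 * t).
  have Jt : J%:R / 2 ^+ n.*2 <= t by rewrite ler_pdivrMr// mulrC truncn_le.
  have tJ : t < J.+1%:R / 2 ^+ n.*2 by rewrite ltr_pdivlMr// mulrC truncnS_gt.
  have Jlt : (J < 2 ^ n.*2)%N.
    by rewrite /J truncn_lt_nat// natrX -[ltRHS]mulr1 ltr_pM2l.
  have h1 : J%:R / 2 ^+ n.*2 <= r.
    rewrite -lee_fin rE -m_itv_dyadic 1?ltnW// le_measure ?inE//.
    by apply: subset_itvl; rewrite bnd_simp.
  have h2 : r <= J.+1%:R / 2 ^+ n.*2.
    rewrite -lee_fin rE -m_itv_dyadic// le_measure ?inE//.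
    by apply: subset_itvl; rewrite bnd_simp ltW.
  move: tJ h2; rewrite -natr1 mulrDl mul1r ler_norml; lra.
apply/eqP; rewrite -subr_eq0 -normr_le0; apply/ler_addgt0Pr => e e0; rewrite add0r.
have [n _ /(_ n (leqnn n)) /ltW ne] := near_pow2V_lt e0.
exact: le_trans (B n) ne.
Qed.

Lemma dyadic_cdf (t : R) : m `]-oo, t[%classic =
  (if t <= 0 then 0 else if t < 1 then t else 1)%:E.
Proof.
have m1 : m `[0, 1[%classic = 1%E.
  by have := m_dyadic 0 0 isT; rewrite double0 expr0 mul0r mul1r invr1.
rewrite (@probability_setI1 _ _ _ m `[0, 1[%classic)//.
have [t0|t0] := leP t 0.
  rewrite (_ : _ `&` _ = set0) ?measure0//.
  apply/seteqP; split => x //= []; rewrite !in_itv/= => xt /andP[x0 _].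
  by move: (le_trans t0 x0); rewrite leNgt xt.
have [t1|t1] := ltP t 1.
  rewrite -(m_itv t) ?t1 ?ltW//; congr (m _); apply/seteqP; split => x /=.
    by rewrite !in_itv/= => -[-> /andP[-> _]].
  by rewrite !in_itv/= => /andP[-> xt]; rewrite xt (lt_trans xt).
rewrite -m1; congr (m _); apply/seteqP; split => x /=; first by case.
by rewrite !in_itv/= => /andP[-> x1]; rewrite x1 (lt_le_trans x1).
Qed.

End dyadic.

(** The half-lines are stable under intersection and generate the Borel sets, so the distribution
    function decides. The exponents are even because [truncn_merge01] describes intervals of length
    [4^-n]. *)
Lemma dyadic_unique (m : probability (measurableTypeR R) R) :
  (forall n j : nat, (j < 2 ^ n.*2)%N ->
    m `[j%:R / 2 ^+ n.*2, j.+1%:R / 2 ^+ n.*2[%classic = ((2 ^+ n.*2)^-1)%:E) ->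
  forall A, measurable A -> m A = unif A.
Proof.
move=> mE A; apply: (@measure_unique _ R (measurableTypeR R) (@RGenInftyO.G R)
  (fun n => `]-oo, n%:R[%classic)).
- exact: RGenInftyO.measurableE.
- move=> _ _ [x ->] [y ->]; exists (Order.min x y).
  by apply/seteqP; split => z /=; rewrite !in_itv/= lt_min => /andP.
- by move=> n; exists n%:R.
- apply/seteqP; split => // x _; exists (Num.truncn x).+1 => //=.
  by rewrite in_itv/= truncnS_gt.
- move=> _ [t ->]; apply: (etrans (dyadic_cdf m mE t)).
  by apply/esym/(dyadic_cdf unif) => n j; exact: unif_dyadic.
- by move=> n; rewrite -ge0_fin_numE//; exact: fin_num_measure.
Qed.

Definition unif2 : set (measurableTypeR R * measurableTypeR R) -> \bar R :=
  (unif \x unif)%E.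

HB.instance Definition _ := Measure.on unif2.
HB.instance Definition _ := Probability.on unif2.

Lemma unif2X A B : measurable A -> measurable B ->
  unif2 (A `*` B) = (unif A * unif B)%E.
Proof. by move=> mA mB; rewrite /unif2 product_measure1E. Qed.

Lemma unif2_itv01 : unif2 (`[0, 1[ `*` `[0, 1[) = 1%E.
Proof. by rewrite /unif2 product_measure1E//= !unif_itv01 mule1. Qed.

Let merge01_mfun : {mfun (measurableTypeR R * measurableTypeR R)%type >->
    measurableTypeR R} :=
  HB.pack (@merge01 R) (isMeasurableFun.Build _ _
    (measurableTypeR R * measurableTypeR R)%type (measurableTypeR R)
    (@merge01 R) measurable_merge01).

(** Inside the unit square, the preimage of a dyadic interval of length [4^-n] is a square of the
    same area. *)
Lemma unif2_merge01 A : measurable A -> unif2 (merge01 @^-1` A) = unif A.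
Proof.
move=> mA; rewrite -(dyadic_unique (distribution unif2 merge01_mfun) _ A mA)//.
move=> n j jlt /=.
rewrite /distribution/= /pushforward.
have mp D : measurable D -> measurable (merge01 @^-1` D : set (R * R)).
  by move=> mD; rewrite -[X in measurable X]setTI; exact: measurable_merge01.
rewrite (probability_setI1 _ _ _ unif2 (`[0, 1[ `*` `[0, 1[))//; last 3 first.
- exact: measurableX.
- exact: mp.
- exact: unif2_itv01.
have [a [b [alt blt H]]] := truncn_merge01 (R := R) n j jlt.
rewrite (_ : _ `&` _ = `[a%:R / 2 ^+ n, a.+1%:R / 2 ^+ n[ `*`
                       `[b%:R / 2 ^+ n, b.+1%:R / 2 ^+ n[).
  apply: etrans; first by apply: unif2X; exact: measurable_itv.
  rewrite !unif_dyadic// -EFinM; congr (_%:E).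
  by rewrite -invfM -exprD addnn.
rewrite -!dyadicE//; apply/seteqP; split => -[x y] /=.
  rewrite !in_itv/= => -[[m01 mj] [x01 y01]].
  by have [] := proj1 (H x y x01 y01) mj.
move=> [[x01 xa] [y01 yb]]; rewrite !in_itv/=; split; last by [].
by split; [exact: merge01_itv|exact/H].
Qed.

(** Pulled back along [merge01], [evens] and [odds] become the two coordinates of the unit square,
    hence are independent and uniform. *)
Lemma unif_split A B : measurable A -> measurable B ->
  unif (evens @^-1` A `&` odds @^-1` B) = (unif A * unif B)%E.
Proof.
move=> mA mB.
have mE : measurable (evens @^-1` A `&` odds @^-1` B : set R).
  apply: measurableI; rewrite -[X in measurable X]setTI.
    exact: measurable_evens.
  exact: measurable_odds.
rewrite -unif2_merge01//.
rewrite -unif2X//.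
rewrite (probability_setI1 _ _ _ unif2 (`[0, 1[ `*` `[0, 1[)); last 3 first.
- exact: measurableX.
- by rewrite -[X in measurable X]setTI; exact: measurable_merge01.
- exact: unif2_itv01.
rewrite [RHS](probability_setI1 _ _ _ unif2 (`[0, 1[ `*` `[0, 1[)); last 3 first.
- exact: measurableX.
- exact: measurableX.
- exact: unif2_itv01.
congr unif2; apply/seteqP; split => -[x y] /=.
  by rewrite !in_itv/= => -[+ [x01 y01]]; rewrite evens_merge01// odds_merge01.
by rewrite !in_itv/= => -[+ [x01 y01]]; rewrite evens_merge01// odds_merge01.
Qed.

(** The last identity fails when the even digits of [x] end in ones, but the exceptional set pulls
    back along [merge01] to a set that misses the unit square. *)
Lemma ae_unif_merge_split : \forall x \ae unif,
  [/\ 0 <= x < 1, 0 <= evens x < 1 & merge01 (evens x, odds x) = x].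
Proof.
pose E : set R := [set x | [/\ 0 <= x < 1, 0 <= evens x < 1 &
  merge01 (evens x, odds x) = x]].
have mE : measurable E.
  rewrite (_ : E = `[0, 1[ `&` evens @^-1` `[0, 1[ `&`
      (fun x => merge01 (evens x, odds x) == x) @^-1` [set true]).
    apply: measurableI; last first.
      rewrite -[X in measurable X]setTI.
      apply: (measurable_fun_eqr _ _) => //.
      apply: measurableT_comp; first exact: measurable_merge01.
      by apply/measurable_fun_pairP; split;
        [exact: measurable_evens|exact: measurable_odds].
    apply: measurableI => //; rewrite -[X in measurable X]setTI.
    exact: measurable_evens.
  apply/seteqP; split => x /=; rewrite !in_itv/=.
    by move=> [? ? /eqP].
  by move=> [[? ?] /eqP].
have E1 : unif E = 1%E.
  rewrite -unif2_merge01//.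
  rewrite (probability_setI1 _ _ _ unif2 (`[0, 1[ `*` `[0, 1[)); last 3 first.
  - exact: measurableX.
  - by rewrite -[X in measurable X]setTI; exact: measurable_merge01.
  - exact: unif2_itv01.
  rewrite -[RHS]unif2_itv01; congr unif2; apply/setIidr => -[x y] /=.
  rewrite !in_itv/= => -[x01 y01]; rewrite /E /= evens_merge01// odds_merge01//.
  by split => //; exact: merge01_itv.
exact: (ae_probability1 _ _ _ unif E mE E1).
Qed.

End uniform_law.

(** * Independent uniform coordinates *)

Section product_space.
Context {R : realType}.

Lemma measurable_coord (i : nat) : measurable_fun setT (fun x : RN R => x i).
Proof.
move=> _ A mA; rewrite setTI; apply: sub_sigma_algebra.
exists i.+1, (fun j => if j == i then A else setT); split.
  by move=> j; case: ifP.
apply/seteqP; split => x /=.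
  by move=> Ax j _; case: ifPn => [/eqP ->|].
by move=> /(_ i (leqnn _)); rewrite eqxx.
Qed.

Lemma measurable_to_RN d (T : measurableType d) (f : T -> RN R) :
  (forall i, measurable_fun setT (fun t => f t i)) -> measurable_fun setT f.
Proof.
move=> mf; apply: (@measurability _ _ T (RN R) setT f (@cylinders R)) => //.
move=> _ [_ [m [C [mC ->]]] <-].
rewrite setTI (_ : _ @^-1` _ = \bigcap_(i in [set i | (i < m)%N])
    ((fun t => f t i) @^-1` C i)).
  apply: bigcap_measurableType => i _.
  by rewrite -[X in measurable X]setTI; exact: mf.
by apply/seteqP; split => t /= H i im; exact: H.
Qed.

Lemma measurable_rect (C : nat -> set R) : (forall i, measurable (C i)) ->
  measurable (rect C : set (RN R)).
Proof.
move=> mC; rewrite (_ : rect C = \bigcap_i ((fun t : RN R => t i) @^-1` C i)).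
  apply: bigcap_measurableType => i _.
  by rewrite -[X in measurable X]setTI; exact: measurable_coord.
by apply/seteqP; split => t /= H i => [_|]; exact: H.
Qed.

Lemma cubeE (a : nat -> int) :
  cube a = rect (fun n => `[(a n)%:~R, (a n)%:~R + 1 : R[%classic).
Proof. by apply/seteqP; split => x /= H n; have := H n; rewrite /= in_itv. Qed.

Lemma measurable_cube (a : nat -> int) : measurable (cube a : set (RN R)).
Proof. by rewrite cubeE; apply: measurable_rect => i; exact: measurable_itv. Qed.

Lemma trivIset_cube (D : set (nat -> int)) : trivIset D (@cube R).
Proof.
move=> a b _ _ [x [ax bx]]; apply/funext => n.
have fl (c : nat -> int) : cube c x -> Num.floor (x n) = c n.
  by move=> /(_ n) cx; apply: floor_def; rewrite intrD.
by rewrite -(fl a ax) -(fl b bx).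
Qed.

(** Almost surely, the digits of coordinate [n] are those of [x] at the positions
    [2^n (2k + 1) - 1]; these classes partition the positions. *)
Definition coords (x : R) : nat -> R := fun n => evens (iter n odds x).

(* The fuel is irrelevant as soon as it exceeds [k]. *)
Fixpoint uncoords_digit (fuel k : nat) (y : nat -> R) : bool :=
  if fuel is f.+1 then
    if odd k then uncoords_digit f k./2 (fun n => y n.+1) else digit k./2 (y 0%N)
  else false.

Definition uncoords (y : nat -> R) : R :=
  bval (fun k => uncoords_digit k.+1 k y).

Lemma uncoords_itv y : 0 <= uncoords y <= 1.
Proof. by rewrite bval_ge0 bval_le1. Qed.

Lemma coordsS x n : coords x n.+1 = coords (odds x) n.
Proof. by rewrite /coords iterSr. Qed.

Lemma measurable_iter_odds n : measurable_fun setT (iter n (@odds R)).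
Proof.
elim: n => [|n IH]; first exact: measurable_id.
by apply: (measurableT_comp (f := @odds R)) => //; exact: measurable_odds.
Qed.

Lemma measurable_coords n : measurable_fun setT (coords^~ n).
Proof.
apply: (measurableT_comp (f := @evens R)); first exact: measurable_evens.
exact: measurable_iter_odds.
Qed.

Lemma measurable_uncoords d (T : measurableType d) (Y : T -> nat -> R) :
  (forall i, measurable_fun setT (Y^~ i)) ->
  measurable_fun setT (fun t => uncoords (Y t)).
Proof.
move=> mY; apply: measurable_bval => k.
move: (k.+1) => f; elim: f k Y mY => [|f IH] k Y mY /=; first exact: measurable_cst.
case: (odd k); first by apply: (IH _ (fun t n => Y t n.+1)) => i; exact: mY.
by apply: (measurableT_comp (f := digit k./2)) => //; exact: measurable_digit.
Qed.

(** Taking the whole line as first event in [unif_split] shows that a single [odds] preserves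
    [unif]. *)
Lemma unif_odds (A : set (measurableTypeR R)) n : measurable A ->
  unif (iter n odds @^-1` A) = unif A.
Proof.
elim: n A => // n IH A mA.
have mo : measurable (odds @^-1` A : set (measurableTypeR R)).
  by rewrite -[X in measurable X]setTI; exact: measurable_odds.
rewrite (_ : iter n.+1 odds @^-1` A = iter n odds @^-1` (odds @^-1` A))// IH//.
rewrite -[odds @^-1` A]setTI -[setT](@preimage_setT _ _ evens) unif_split//.
by rewrite (@probability_setT _ _ _ unif) mul1e.
Qed.

Lemma ae_unif_iter_odds (P : R -> Prop) :
  (\forall x \ae unif, P x) -> \forall x \ae unif, forall n, P (iter n odds x).
Proof.
move=> [A [mA A0 PA]]; apply: ae_foralln => n.
exists (iter n odds @^-1` A); split.
- by rewrite -[X in measurable X]setTI; exact: measurable_iter_odds.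
- exact: etrans (unif_odds A n mA) A0.
- by move=> x /= Px; exact: PA.
Qed.

Lemma ae_coords : \forall x \ae unif,
  (forall n, 0 <= coords x n < 1) /\ uncoords (coords x) = x.
Proof.
have := ae_unif_iter_odds _ ae_unif_merge_split.
apply: (@filterS _ _ (ae_filter_ringOfSetsType (T := measurableTypeR R) (@unif R))).
move=> x H; split; first by move=> n; have [] := H n.
have [x01 _ _] := H 0%N.
rewrite -[RHS]bval_digit//; congr bval; apply/funext => k.
(* Induction on the fuel: [H] passes from [x] to [odds x], and an odd position [k] of [x] is
   position [k./2] of [odds x]. *)
move Ef : k.+1 => f; have : (k < f)%N by rewrite -Ef.
elim: f k x H {x01 Ef} => // f IH k x H kf /=.
have /= [_ e01 xE] := H 0%N.
case: ifPn => ok.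
  rewrite (_ : (fun n => coords x n.+1) = coords (odds x)); last first.
    by apply/funext => n; exact: coordsS.
  rewrite IH; last 2 first.
  - by move=> n; have := H n.+1; rewrite iterSr.
  - by lia.
  rewrite -[in RHS]xE -[in RHS](odd_double_half k) ok add1n.
  by rewrite digit_merge01_odd.
rewrite -[in RHS]xE -[in RHS](odd_double_half k) (negbTE ok) add0n.
by rewrite digit_merge01_even.
Qed.

(** [unif_split] separates coordinate [0], made of the even digits, from the others, which are the
    coordinates of [odds x]. *)
Lemma unif_coords (D : nat -> set R) n :
  (forall i, measurable (D i)) ->
  unif [set x | forall i, (i < n)%N -> D i (coords x i)] =
  (\prod_(i < n) unif (D i))%E.
Proof.
elim: n D => [|n IH] D mD.
  rewrite big_ord0 -[RHS](@probability_setT _ _ _ (@unif R)).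
  by congr unif; apply/seteqP; split => // x _ i.
rewrite big_ord_recl/=; under eq_bigr do rewrite /bump leq0n add1n.
rewrite -(IH (fun i => D i.+1))//.
rewrite -unif_split//; last first.
  rewrite (_ : [set x | _] = \bigcap_(i in [set i | (i < n)%N])
    (coords^~ i @^-1` D i.+1)).
    apply: bigcap_measurableType => i _.
    by rewrite -[X in measurable X]setTI; exact: measurable_coords.
  by apply/seteqP; split => t /= H i im; exact: H.
congr unif; apply/seteqP; split => x /=.
  by move=> H; split=> [|i im]; [exact: (H 0%N)|rewrite -coordsS; exact: H].
by move=> [H0 H] [//|i im]; rewrite coordsS; exact: H.
Qed.

End product_space.

(** * The measure on a cube *)

Lemma lebesgue_measure_translate (R : realType) (c : R) (A : set R) :
  measurable A ->
  lebesgue_measure ((fun x : R => x + c) @^-1` A) = lebesgue_measure A.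
Proof.
move=> mA; rewrite -[LHS]/(pushforward (@lebesgue_measure R)
  ((fun x => x + c) : _ -> measurableTypeR R) A).
apply/esym/lebesgue_measure_unique => //=.
  exact: measurable_funD.
move=> _ _ [[a b]] _ <-.
rewrite /pushforward (_ : _ @^-1` _ = `]a - c, b - c]%classic); last first.
  by apply/seteqP; split => x /=; rewrite !in_itv/= ltrBlDr lerBrDr.
rewrite !lebesgue_measure_itv/= !lte_fin ltrD2r -!EFinB.
by congr (if _ then _%:E else _); ring.
Qed.

Lemma probability_setC0 d (T : measurableType d) (R : realType)
    (P : probability T R) (A : set T) :
  measurable A -> P (~` A) = 0%E -> P A = 1%E.
Proof.
move=> mA A0; rewrite -[A]setCK probability_setC; last exact: measurableC.
by rewrite A0 sube0.
Qed.

Section cube_law.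
Context {R : realType}.

(** Its law under [unif] is the measure called [P_a] above. *)
Definition coordsz (a : nat -> int) (x : R) : RN R :=
  fun n => coords x n + (a n)%:~R.

Lemma measurable_coordsz a : measurable_fun setT (coordsz a).
Proof.
apply: measurable_to_RN => i; apply: measurable_funD => //.
exact: measurable_coords.
Qed.

Lemma measurable_coordsz_preimage a (A : set (RN R)) : measurable A ->
  measurable (coordsz a @^-1` A).
Proof. by move=> mA; rewrite -[X in measurable X]setTI; exact: measurable_coordsz. Qed.

Lemma unif_le_leb (A : set R) : measurable A -> (unif A <= leb A)%E.
Proof. by move=> mA; apply: le_measure; rewrite ?inE//; exact: measurableI. Qed.

Lemma unif_translate_le (c : R) (A : set R) : measurable A ->
  (unif ((fun x : R => (x + c)%R) @^-1` A) <= leb A)%E.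
Proof.
move=> mA; rewrite /leb -(lebesgue_measure_translate _ c)//.
by apply: unif_le_leb; rewrite -[X in measurable X]setTI; exact: measurable_funD.
Qed.

(** Independence bounds the mass of the cylinder over the first [n] sides by the product of their
    lengths; the bound passes to the limit of these partial products. *)
Lemma unif_rect_le a (C : nat -> set R) v : finite_rect C v ->
  (unif (coordsz a @^-1` rect C) <= v%:E)%E.
Proof.
move=> [mC Cv].
have mCa i : measurable ((fun x => x + (a i)%:~R) @^-1` C i : set R).
  by rewrite -[X in measurable X]setTI; exact: measurable_funD.
have le_prod n : (\prod_(i < n) unif ((fun x : R => (x + (a i)%:~R)%R) @^-1` C i)
    <= \prod_(i < n) leb (C i))%E.
  elim: n => [|n IH]; first by rewrite !big_ord0.
  rewrite !big_ord_recr/=; apply: lee_pmul => //.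
  - by apply: prode_ge0 => i _; exact: (measure_ge0 (@unif R)).
  - exact: unif_translate_le.
rewrite -(cvg_lim _ Cv)//; apply: lime_ge; first by apply/cvg_ex; exists v%:E.
near=> n; apply: (@le_trans _ _ (unif [set x | forall i, (i < n)%N ->
   ((fun x => x + (a i)%:~R) @^-1` C i) (coords x i)])).
  apply: le_measure; rewrite ?inE.
  - by apply: measurable_coordsz_preimage; exact: measurable_rect.
  - rewrite (_ : [set x | _] = \bigcap_(i in [set i | (i < n)%N])
      (coords^~ i @^-1` ((fun x => x + (a i)%:~R) @^-1` C i))).
      apply: bigcap_measurableType => i _.
      by rewrite -[X in measurable X]setTI; exact: measurable_coords.
    by apply/seteqP; split => t /= H i im; exact: H.
  - by move=> x /= H i _; exact: H.
by rewrite (unif_coords (fun i => (fun x => x + (a i)%:~R) @^-1` C i)).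
Unshelve. all: end_near. Qed.

(** Countable subadditivity gives the bound for every cover by finite rectangles, hence for the
    infimum. *)
Lemma unif_le_mustar a (A : set (RN R)) : measurable A ->
  (unif (coordsz a @^-1` A) <= mustar A)%E.
Proof.
move=> mA; apply: le_ereal_inf_tmp => _ [C [v [Cv [AC ->]]]].
have mC n : measurable (coordsz a @^-1` rect (C n)).
  apply: measurable_coordsz_preimage; apply: measurable_rect => i.
  by have [] := Cv n.
apply: (@le_trans _ _ (\sum_(0 <= n <oo) unif (coordsz a @^-1` rect (C n)))%E).
  apply: measure_sigma_subadditive => //; first exact: measurable_coordsz_preimage.
  by move=> x /AC[n _ Cx]; exists n.
by apply: lee_nneseries => // n _; exact: unif_rect_le.
Qed.

Lemma unif_cube a : unif (coordsz a @^-1` cube a) = 1%E.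
Proof.
have [N [mN N0 NS]] := @ae_coords R.
have mc := measurable_coordsz_preimage a _ (measurable_cube a).
have sub : ~` (coordsz a @^-1` cube a) `<=` N.
  move=> x H; apply: NS => -[H01 _]; apply: H => n; rewrite /coordsz.
  by rewrite lerDr addrC ltrD2l.
have H0 : unif (~` (coordsz a @^-1` cube a)) = 0%E.
  by apply: (@subset_measure0 _ _ _ (@unif R) _ N) => //; exact: measurableC.
exact: (probability_setC0 _ _ _ (@unif R) _ mc H0).
Qed.

Section mu.
Variable mu : {measure set (RN R) -> \bar R}.
Hypothesis hmu : forall A : set (RN R), measurable A -> mu A = mustar A.

Lemma mu_cube_le1 a : (mu (cube a) <= 1)%E.
Proof.
rewrite hmu; last exact: measurable_cube.
apply: ereal_inf_lbound.
(* The cover is the cube itself followed by empty rectangles. *)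
exists (fun n i => if n == 0%N then `[(a i)%:~R, (a i)%:~R + 1[%classic else set0).
exists (fun n => if n == 0%N then 1 else 0); split.
  case=> [|n]; split => //=.
    rewrite (_ : (fun n => _) = cst 1%E); first exact: cvg_cst.
    apply/funext => n; rewrite big1// => i _; rewrite /leb lebesgue_measure_itv/=.
    by rewrite lte_fin ltrDl ltr01 -EFinB addrC addKr.
  (* The empty product at index [0] is [1]; once it is dropped, the partial products vanish. *)
  rewrite -cvg_shiftS (_ : (fun n => _) = cst 0%E); first exact: cvg_cst.
  by apply/funext => k; rewrite big_ord_recl /leb measure0 mul0e.
split; first by move=> x /= H; exists 0%N => //=; rewrite -cubeE.
rewrite nneseries_recl//; last by case.
by rewrite eseries0 ?adde0//; case.
Qed.

Lemma mu_cube a (A : set (RN R)) : measurable A ->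
  mu (A `&` cube a) = unif (coordsz a @^-1` A).
Proof.
have mc := measurable_cube (R := R) a.
have le_mu B : measurable B -> (unif (coordsz a @^-1` B) <= mu (B `&` cube a))%E.
  move=> mB; rewrite hmu; last exact: measurableI.
  (* [P_a] is carried by the cube, so [B] can be cut down to the cube before the comparison with
     [mustar]. *)
  rewrite (probability_setI1 _ _ _ (@unif R) (coordsz a @^-1` cube a)).
  - by apply: unif_le_mustar; exact: measurableI.
  - exact: measurable_coordsz_preimage.
  - exact: measurable_coordsz_preimage.
  - exact: unif_cube.
move=> mA; apply/eqP; rewrite eq_le le_mu// andbT.
have mcA : measurable (coordsz a @^-1` A) by exact: measurable_coordsz_preimage.
(* The two parts weigh at most [1] together, while their lower bounds add up to exactly [1], so
   neither inequality is strict. *)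
have : (mu (A `&` cube a) + mu (~` A `&` cube a) <= 1)%E.
  rewrite -measureU; [|exact: measurableI| |].
  - by rewrite -setIUl setUv setTI mu_cube_le1.
  - by apply: measurableI => //; exact: measurableC.
  - by rewrite setIACA setICr set0I.
have := le_mu _ (measurableC mA).
have -> : unif (coordsz a @^-1` ~` A) = (1 - unif (coordsz a @^-1` A))%E.
  by rewrite preimage_setC; exact: (probability_setC (@unif R)).
have wfin : unif (coordsz a @^-1` A) \is a fin_num by exact: (fin_num_measure (@unif R)).
have x0 : (0 <= mu (A `&` cube a))%E by [].
have y0 : (0 <= mu (~` A `&` cube a))%E by [].
move: x0 y0 wfin; move: (mu (A `&` _)) (mu (~` A `&` _)) (unif _) => x y w.
case: w => // w; case: x => // x; case: y => // y x0 y0 _.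
by rewrite -EFinB -EFinD !lee_fin; lra.
Qed.

End mu.
End cube_law.

(** * Cardinality and countable unions *)

Lemma injective_card_le {T : Type} {U : pointedType} (f : T -> U) :
  injective f -> ([set: T] #<= [set: U])%card.
Proof. by move=> fi; apply/pcard_injP; exists f => x y _ _; exact: fi. Qed.

HB.instance Definition _ := isPointed.Build int 0.

(** A real is determined by the integer parts of all [2^n x]; a sequence of integers is coded by its
    graph, a set of naturals read as binary digits. *)
Lemma bijection_reals_int_sequences (R : realType) :
  exists e : R -> (nat -> int), set_bij setT setT e.
Proof.
apply/card_set_bijP/Cantor_Bernstein.
  apply: (injective_card_le (fun (x : R) (n : nat) => Num.floor (2 ^+ n * x))) => x y xy.
  have fE n : Num.floor (2 ^+ n * x) = Num.floor (2 ^+ n * y).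
    exact: (congr1 (fun h : nat -> int => h n) xy).
  apply/eqP; rewrite -subr_eq0 -normr_le0; apply/ler_addgt0Pr => e e0; rewrite add0r.
  have [n _ /(_ n (leqnn n)) /ltW ne] := near_pow2V_lt e0.
  apply: le_trans ne; have p0 : 0 < 2 ^+ n :> R by rewrite exprn_gt0.
  rewrite -(ler_pM2l p0) mulfV ?gt_eqF// -{1}(gtr0_norm p0) -normrM mulrBr.
  have /andP[x1 x2] := floor_itv (2 ^+ n * x).
  have /andP[y1 y2] := floor_itv (2 ^+ n * y).
  by move: x1 x2 y1 y2; rewrite fE intrD ler_norml; lra.
pose b (s : nat -> int) (k : nat) :=
  if choice.unpickle k is Some (i, z) then s i == z else false.
(* The zeros inserted at even positions prevent the expansion from ending in ones, so the digits can
   be read back. *)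
apply: (injective_card_le (fun s => bval (interleave (fun=> false) (b s)) : R)) => s t st.
apply/funext => i.
have ne1 s' : not_eventually1 (interleave (fun=> false) (b s')).
  by apply: not_eventually1_interleave => n; exists n.
have E k : b s k = b t k.
  have := congr1 (digit k.*2.+1) st.
  by rewrite !digit_bval// !interleave_odd.
by have := E (choice.pickle (i, s i)); rewrite /b choice.pickleK eqxx => /esym/eqP.
Qed.

Lemma countable_esum_support (R : realType) (T : choiceType) (a : T -> \bar R) :
  (forall t, 0 <= a t)%E -> (\esum_(t in [set: T]) a t < +oo)%E ->
  countable [set t | a t != 0%E].
Proof.
move=> a0 aoo.
have -> : [set t | a t != 0%E] = \bigcup_n [set t | ((n.+1%:R^-1)%:E <= a t)%E].
  apply/seteqP; split => t /=.
    move=> at0; have {at0} : (0 < a t)%E by rewrite lt0e at0 a0.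
    case E : (a t) => [r| |]//; last by move=> _; exists 0%N => //=; rewrite E leey.
    rewrite lte_fin => r0; exists (Num.truncn r^-1) => //=.
    rewrite E lee_fin invf_ple ?posrE//; exact/ltW/truncnS_gt.
  move=> [n _ /=] h; rewrite gt_eqF//; apply: lt_le_trans h.
  by rewrite lte_fin invr_gt0.
apply: bigcup_countable => // n _; apply: finite_set_countable.
apply: contrapT => /infinite_set_fset inf.
have sfin : (\esum_(t in [set: T]) a t)%E \is a fin_num.
  by rewrite ge0_fin_numE//; exact: esum_ge0.
pose s := fine (\esum_(t in [set: T]) a t)%E.
(* More than [s (n + 1)] terms of size at least [1 / (n + 1)] add up to more than [s]. *)
have [B BA Bn] := inf (Num.truncn (s * n.+1%:R)).+1.
have : (\sum_(t <- B) a t <= s%:E)%E.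
  rewrite fineK//; apply: esum_ge; exists [set` B] => //.
  by rewrite fsbig_finite//= set_fsetK.
apply/negP; rewrite -ltNge.
apply: (@lt_le_trans _ _ (\sum_(t <- B) (n.+1%:R^-1)%:E)%E); last first.
  by rewrite big_seq [leRHS]big_seq; apply: lee_sum => t tB; exact: BA.
rewrite sumEFin lte_fin big_const_seq count_predT iter_addr addr0 -[ltRHS]mulr_natl.
rewrite ltr_pdivlMr//; apply: lt_le_trans (truncnS_gt _) _.
by rewrite ler_nat.
Qed.

Lemma measurable_countable_bigcup d (T : measurableType d) (I : Type)
    (J : set I) (F : I -> set T) :
  countable J -> (forall i, J i -> measurable (F i)) ->
  measurable (\bigcup_(i in J) F i).
Proof.
move=> cJ mF; rewrite bigcup_set_type; apply: countable_bigcupT_measurable.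
  by rewrite (eq_countable (card_setT _)).
by move=> [i iJ] /=; apply: mF; exact: set_mem.
Qed.

Lemma measurable_fun_countable_bigcup d d' (T : measurableType d)
    (U : measurableType d') (I : Type) (J : set I) (F : I -> set T) (f : T -> U) :
  countable J -> (forall i, J i -> measurable (F i)) ->
  (forall i, J i -> measurable_fun (F i) f) ->
  measurable_fun (\bigcup_(i in J) F i) f.
Proof.
move=> cJ mF mf _ B mB; rewrite setI_bigcupl.
by apply: measurable_countable_bigcup => // i Ji; apply: mf => //; exact: mF.
Qed.

Lemma ge0_integral_countable_bigcup d (T : measurableType d) (R : realType)
    (mu : {measure set T -> \bar R}) (I : choiceType) (J : set I)
    (F : I -> set T) (f : T -> \bar R) :
  countable J -> (forall i, J i -> measurable (F i)) -> trivIset J F ->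
  measurable_fun (\bigcup_(i in J) F i) f -> (forall x, 0 <= f x)%E ->
  (\int[mu]_(x in \bigcup_(i in J) F i) f x =
   \esum_(i in J) \int[mu]_(x in F i) f x)%E.
Proof.
move=> cJ mF tF mf f0; have /countable_injP[g ginj] := cJ.
pose E n := \bigcup_(i in J `&` [set i | g i = n]) F i.
have EF i : J i -> E (g i) = F i.
  move=> Ji; apply/seteqP; split => [x [j [Jj gji] Fx]|x Fx]; last by exists i.
  by rewrite (ginj i j)// inE.
have UE : \bigcup_(i in J) F i = \bigcup_n E n.
  apply/seteqP; split => [x [i Ji Fx]|x [n _ [i [Ji _] Fx]]]; last by exists i.
  by exists (g i) => //; rewrite EF.
have En0 n : ~ (g @` J) n -> E n = set0.
  by move=> nJ; apply/seteqP; split => // x [i [Ji gi] _]; case: nJ; exists i.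
have mE n : measurable (E n).
  have [[i Ji <-]|nJ] := pselect ((g @` J) n); first by rewrite EF//; exact: mF.
  by rewrite En0.
have tE : trivIset setT E.
  move=> m n _ _ [x [[i [Ji <-] Fix] [j [Jj <-] Fjx]]].
  by congr g; apply: tF => //; exists x.
rewrite UE ge0_integral_bigcup//; last by rewrite -UE.
rewrite nneseries_esumT; last by move=> n; exact: integral_ge0.
transitivity (\esum_(n in g @` J) \int[mu]_(x in E n) f x)%E.
  rewrite [RHS]esum_mkcond; apply: eq_esum => n _.
  case: ifPn => //; rewrite notin_setE => /En0 ->; exact: integral_set0.
rewrite esum_image//; apply: eq_esum => i Ji; by rewrite EF.
Qed.

(** * The isometry *)

Section transfer.
Context {R : realType}.

Lemma integral_unif (g : R -> \bar R) :
  measurable_fun (`[0, 1]%classic : set (measurableTypeR R)) g ->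
  (\int[@lebesgue_measure R]_(x in `[0%R, 1%R]) g x =
   \int[@unif R]_(x in `[0%R, 1%R[) g x)%E.
Proof.
move=> mg; rewrite -integral_itv_bndo_bndc; last first.
  by apply: measurable_funS mg => //; exact: subset_itv_co_cc.
apply: eq_measure_integral => A mA AI.
by apply/esym; rewrite /unif /mrestr; apply: (congr1 lebesgue_measure); apply/setIidl.
Qed.

Lemma measurable_powR_norm d (T : measurableType d) (D : set T) (p : R) (f : T -> R) :
  measurable_fun D f -> measurable_fun D (fun x => (`|f x| `^ p)%:E).
Proof.
move=> mf; apply/measurable_EFinP.
apply: (measurableT_comp (f := @powR R ^~ p)) => //.
exact: (measurableT_comp (f := @Num.Def.normr R R)).
Qed.

Lemma pint01_ae (p : R) (g h : R -> R) :
  measurable_fun (`[0, 1]%classic : set (measurableTypeR R)) g ->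
  measurable_fun (`[0, 1]%classic : set (measurableTypeR R)) h ->
  (\forall x \ae @unif R, g x = h x) -> pint01 p g = pint01 p h.
Proof.
move=> mg mh [N [mN N0 gh]]; rewrite /pint01.
rewrite integral_unif; last exact: measurable_powR_norm.
rewrite integral_unif; last exact: measurable_powR_norm.
apply: (ge0_ae_eq_integral (mu := @unif R)) => //.
- apply: measurable_powR_norm.
  by apply: measurable_funS mg => //; exact: subset_itv_co_cc.
- apply: measurable_powR_norm.
  by apply: measurable_funS mh => //; exact: subset_itv_co_cc.
exists N; split => // x /= H; apply: gh => ghx; apply: H => _.
by rewrite /= ghx.
Qed.

Lemma pint01_cst0 (p : R) : p != 0 -> pint01 p (fun=> 0) = 0%E.
Proof.
by move=> p0; apply: integral0_eq => x _; rewrite normr0 powR0.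
Qed.

Variables (p : R) (mu : {measure set (RN R) -> \bar R}).
Hypothesis hmu : forall A : set (RN R), measurable A -> mu A = mustar A.

(** By [mu_cube], the restriction of [mu] to the cube is the image of [unif] under [coordsz a]; the
    rest is a change of variables. *)
Lemma pint_cube a (f : RN R -> R) : measurable_fun setT f ->
  pint mu p (cube a) f = pint01 p (f \o coordsz a).
Proof.
move=> mf; have mcz := measurable_coordsz (R := R) a.
have mg : measurable_fun setT (fun x => (`|f x| `^ p)%:E) by exact: measurable_powR_norm.
have mc := measurable_cube (R := R) a.
have mC := measurable_coordsz_preimage a _ mc.
have mgc : measurable_fun setT (fun x : measurableTypeR R => (`|f (coordsz a x)| `^ p)%:E).
  exact: (measurableT_comp mg mcz).
have g0 x : (0 <= (`|f x| `^ p)%:E)%E by rewrite lee_fin powR_ge0.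
rewrite /pint /pint01 integral_unif; last exact: measurable_funTS.
transitivity (\int[pushforward (@unif R) (coordsz a)]_(x in cube a) (`|f x| `^ p)%:E)%E.
  apply: eq_measure_integral => A mA Aa.
  by rewrite /= /pushforward -(mu_cube _ hmu)//; congr (mu _); apply/esym/setIidl.
rewrite ge0_integral_pushforward//; last exact: measurable_funTS.
(* The preimage of the cube and [[0, 1[] may differ, but both have full measure, so both integrals
   equal the one over the line. *)
transitivity (\int[@unif R]_x (`|f (coordsz a x)| `^ p)%:E)%E.
  rewrite [RHS](@ge0_negligible_integral _ _ _ (@unif R) setT (~` (coordsz a @^-1` cube a)))//.
  - by rewrite setDE setTI setCK.
  - exact: measurableC.
  - exact: (probability_setC1 _ _ _ (@unif R) _ mC (unif_cube a)).
rewrite (@ge0_negligible_integral _ _ _ (@unif R) setT (~` `[0, 1[))//.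
- by rewrite setDE setTI setCK.
- exact: measurableC.
- apply: (probability_setC1 _ _ _ (@unif R)); first exact: measurable_itv.
  exact: unif_itv01.
Qed.

End transfer.

(** * Slicing a function along the cubes *)

Section isometry.
Context {R : realType}.
Variables (p : R) (mu : {measure set (RN R) -> \bar R}).
Hypothesis p0 : p != 0.
Hypothesis hmu : forall A : set (RN R), measurable A -> mu A = mustar A.
Variable e : R -> (nat -> int).
Hypothesis ebij : set_bij setT setT e.

Let einj : injective e.
Proof. by case: ebij => _ ei _ k l /ei; apply; rewrite inE. Qed.

(** This is the isometry. Acting by composition, it is linear pointwise, not only almost
    everywhere. *)
Definition slices (f : RN R -> R) : R -> R -> R := fun k x => f (coordsz (e k) x).

Lemma pint01_ge0 (g : R -> R) : (0 <= pint01 p g)%E.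
Proof. by apply: integral_ge0 => x _; rewrite lee_fin powR_ge0. Qed.

(** Cubes outside [Ocal] contribute zero, so the sum may range over all integer sequences, which [e]
    indexes by the reals. *)
Lemma esum_slices f : measurable_fun setT f ->
  (\esum_(k in [set: R]) pint01 p (slices f k) =
   \esum_(a in Ocal mu p f) pint mu p (cube a) f)%E.
Proof.
move=> mf; rewrite [RHS]esum_mkcond (reindex_esum setT setT e)//.
apply: eq_esum => k _; rewrite -[pint01 _ _]/(pint01 p (f \o coordsz (e k))).
rewrite -(pint_cube p mu)//; case: ifPn => //; rewrite notin_setE /Ocal /=.
by move=> /negP/negPn/eqP.
Qed.

Lemma measurable_slices f k D : measurable_fun setT f ->
  measurable_fun (D : set (measurableTypeR R)) (slices f k).
Proof.
move=> mf; apply: measurable_funTS; apply: (measurableT_comp mf).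
exact: measurable_coordsz.
Qed.

(** * Gluing a family into a function *)

Section glue.
Variable u : R -> R -> R.
Hypothesis ulp : inlp p u.

Let K : set R := [set k | pint01 p (u k) != 0%E].

(** Only the countably many cubes in the support [K] are filled, which keeps the function
    measurable. The index chosen by [cid] is unique, as cubes are disjoint and [e] is injective. *)
Definition glue (y : RN R) : R :=
  if pselect (exists k, K k /\ cube (e k) y) is left H then
    u (sval (cid H)) (uncoords (fun n => y n - (e (sval (cid H)) n)%:~R))
  else 0.

Let glueE k y : K k -> cube (e k) y ->
  glue y = u k (uncoords (fun n => y n - (e k n)%:~R)).
Proof.
move=> Kk ky; rewrite /glue; case: pselect => [H|[]]; last by exists k.
case: (cid H) => l /= [Kl ly].
suff -> : l = k by [].
by apply: einj; apply: (trivIset_cube setT) => //; exists y.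
Qed.

Let glue0 y : ~ (exists k, K k /\ cube (e k) y) -> glue y = 0.
Proof. by rewrite /glue; case: pselect. Qed.

Let cK : countable K.
Proof.
apply: countable_esum_support; last by case: ulp.
by move=> k; exact: pint01_ge0.
Qed.

Let F : set (RN R) := \bigcup_(k in K) cube (e k).

Let mF : measurable F.
Proof. by apply: measurable_countable_bigcup => // k _; exact: measurable_cube. Qed.

Lemma measurable_glue : measurable_fun setT glue.
Proof.
rewrite -(setUv F); apply/measurable_funU => //; first exact: measurableC.
split; last first.
  apply: (eq_measurable_fun (cst 0 : RN R -> R)); last exact: measurable_cst.
  move=> y; rewrite inE => nFy; rewrite glue0// => -[k [Kk ky]].
  by apply: nFy; exists k.
apply: measurable_fun_countable_bigcup => // k Kk; first exact: measurable_cube.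
apply: (eq_measurable_fun (fun y : RN R => u k (uncoords (fun n => y n - (e k n)%:~R)))).
  by move=> y; rewrite inE => ky; rewrite (glueE k).
(* [u k] is only known to be measurable on [[0, 1]], which contains the range of [uncoords]. *)
apply: (@measurable_comp _ _ _ _ _ _ (`[0, 1]%classic : set (measurableTypeR R))).
- exact: measurable_itv.
- by move=> _ [y _ <-] /=; rewrite in_itv/= uncoords_itv.
- by case: ulp.
- apply: measurable_funTS.
  apply: (measurable_uncoords _ _ (fun (y : RN R) n => y n - (e k n)%:~R)) => i.
  by apply: measurable_funB => //; exact: measurable_coord.
Qed.

(** For almost every [x], the point [coordsz (e k) x] lies in [cube (e k)], hence in no other cube,
    and [uncoords] recovers [x] from it. *)
Lemma ae_slices_glue k : \forall x \ae @unif R,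
  slices glue k x = if k \in K then u k x else 0.
Proof.
have [N [mN N0 HN]] := @ae_coords R.
exists N; split => // x H; apply: HN => -[c01 ux]; apply: H => /=.
have kx : cube (e k) (coordsz (e k) x).
  by move=> n; rewrite /coordsz lerDr addrC ltrD2l.
case: ifPn => [/set_mem Kk|]; last first.
  rewrite notin_setE => nK; rewrite /slices glue0// => -[l [Kl lx]].
  apply: nK; suff -> : k = l by [].
  by apply: einj; apply: (trivIset_cube setT) => //; exists (coordsz (e k) x).
rewrite /slices (glueE k)//; congr u; rewrite -[RHS]ux; congr uncoords.
by apply/funext => n; rewrite /coordsz addrK.
Qed.

Let measurable_ifK k : measurable_fun (`[0, 1]%classic : set (measurableTypeR R))
  (fun x => if k \in K then u k x else 0).
Proof. by case: (k \in K) => //; case: ulp. Qed.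

Lemma pint01_slices_glue k : pint01 p (slices glue k) = pint01 p (u k).
Proof.
transitivity (pint01 p (fun x => if k \in K then u k x else 0)).
  apply: pint01_ae => //; last exact: ae_slices_glue.
  by apply: measurable_slices; exact: measurable_glue.
have [//|] := boolP (k \in K); rewrite notin_setE /K /= => /negP/negPn/eqP ->.
exact: pint01_cst0.
Qed.

Lemma pint01_slices_glueB k : pint01 p (fun x => slices glue k x - u k x) = 0%E.
Proof.
have mu1 : measurable_fun (`[0, 1]%classic : set (measurableTypeR R)) (u k).
  by case: ulp.
transitivity (pint01 p (fun x => (if k \in K then u k x else 0) - u k x)).
  apply: pint01_ae.
  - apply: measurable_funB => //.
    by apply: measurable_slices; exact: measurable_glue.
  - exact: measurable_funB.
  - have [N [mN N0 HN]] := ae_slices_glue k.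
    by exists N; split => // x H; apply: HN => E; apply: H; rewrite /= E.
have [_|] := boolP (k \in K).
  rewrite -[RHS](pint01_cst0 _ p0); congr pint01; apply/funext => x.
  by rewrite subrr.
(* Off [K] the difference is [- u k], whose integral vanishes by the definition of [K]. *)
rewrite notin_setE /K /= => /negP/negPn/eqP <-.
rewrite /pint01; apply: eq_integral => x _; by rewrite sub0r normrN.
Qed.

Lemma Ocal_glue : Ocal mu p glue = e @` K.
Proof.
have pe k : pint mu p (cube (e k)) glue = pint01 p (u k).
  rewrite pint_cube//; last exact: measurable_glue.
  exact: pint01_slices_glue.
apply/seteqP; split => [a|_ [k Kk <-]]; last by rewrite /Ocal /= pe.
case: ebij => _ _ /(_ a Logic.I)[k _ <-]; rewrite /Ocal /= pe => Kk.
by exists k.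
Qed.

(** [glue] vanishes off [F], which is the union of the cubes in its [Ocal]; since these are
    countably many, both equalities defining [G^p] follow from countable additivity. *)
Lemma inGp_glue : inGp mu p glue.
Proof.
have mg := measurable_powR_norm _ _ _ p _ measurable_glue.
have OF : Fcal mu p glue = F.
  by rewrite /Fcal Ocal_glue bigcup_image.
have cO : countable (Ocal mu p glue).
  by rewrite Ocal_glue; exact: (card_le_trans (card_image_le _ _) cK).
have EF : pint mu p F glue = (\esum_(a in Ocal mu p glue) pint mu p (cube a) glue)%E.
  rewrite -OF /Fcal /pint ge0_integral_countable_bigcup//.
  - by move=> a _; exact: measurable_cube.
  - exact: trivIset_cube.
  - exact: measurable_funTS.
have ET : pint mu p setT glue = pint mu p F glue.
  rewrite /pint -(setUv F) ge0_integral_setU//.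
  - rewrite [X in (_ + X)%E](_ : _ = 0%E) ?adde0//.
    apply: integral0_eq => y nFy; rewrite glue0 ?normr0 ?powR0// => -[k [Kk ky]].
    by apply: nFy; exists k.
  - exact: measurableC.
  - by rewrite setUv.
  - by apply/disj_setPS; rewrite setICr.
split; last by rewrite OF EF ET EF.
split; first exact: measurable_glue.
rewrite ET EF -esum_slices; last exact: measurable_glue.
by under eq_esum do rewrite pint01_slices_glue; case: ulp.
Qed.

End glue.
End isometry.

Theorem theorem3p4 (R : realType) (p : R) (hp : 1 <= p)
  (mu : {measure set (RN R) -> \bar R})
  (hmu : forall A : set (RN R), measurable A -> mu A = mustar A) :
  exists T : (RN R -> R) -> (R -> R -> R),
    (forall f, inGp mu p f -> inlp p (T f)) /\
    (forall (f g : RN R -> R) (a b : R), inGp mu p f -> inGp mu p g ->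
       lp_norm p (fun k x => T (fun y => a * f y + b * g y) k x
                             - (a * T f k x + b * T g k x)) = 0%E) /\
    (forall f, inGp mu p f -> lp_norm p (T f) = Gp_norm mu p f) /\
    (forall u, inlp p u ->
       exists f, inGp mu p f /\ lp_norm p (fun k x => T f k x - u k x) = 0%E).
Proof.
have p0 : p != 0 by rewrite gt_eqF// (lt_le_trans ltr01).
have [e ebij] := bijection_reals_int_sequences R.
(* The first equality defining [G^p] turns the sum over the cubes into the integral over the whole
   space. *)
have esumE f : inGp mu p f ->
    (\esum_(k in [set: R]) pint01 p (slices e f k))%E = pint mu p setT f.
  by move=> [[mf _] [-> _]]; exact: esum_slices.
have norm0 (w : R -> R -> R) : (forall k, pint01 p (w k) = 0%E) -> lp_norm p w = 0%E.
  by move=> w0; rewrite /lp_norm esum1// poweR0r// invr_eq0.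
exists (slices e); split; [|split; [|split]].
- move=> f fG; split; last by rewrite esumE//; case: fG => -[].
  by move=> k; apply: measurable_slices; case: fG => -[].
- move=> f g a b _ _; apply: norm0 => k.
  rewrite -[RHS](pint01_cst0 _ p0); congr pint01; apply/funext => x.
  by rewrite /slices subrr.
- by move=> f fG; rewrite /lp_norm esumE.
- move=> u ulp; exists (glue p e u); split; first exact: inGp_glue.
  by apply: norm0 => k; exact: pint01_slices_glueB.
Qed.
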